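(* Let $(H,\circ)$ be a hypersemigroup. Then $H$ is intra-regular if and only if, for every fuzzy subset $f$ of $H$, we have $f\preceq 1\circ f\circ f\circ 1$.
   Context: Let $\mathcal{P}^*(H)$ denote the set of nonempty subsets of $H$. A hypergroupoid is a nonempty set $H$ with a hyperoperation $\circ: H\times H\to \mathcal{P}^*(H)$, $(a,b)\mapsto a\circ b$; it induces an operation $*$ on $\mathcal{P}^*(H)$ by $A*B=\bigcup_{(a,b)\in A\times B}(a\circ b)$. A hypersemigroup is a hypergroupoid $H$ such that $(x\circ y)*\{z\}=\{x\}*(y\circ z)$ for all $x,y,z\in H$. A hypersemigroup $H$ is called intra-regular if for every $a\in H$ there exist $x,y\in H$ such that $a\in (x\circ a)*(a\circ y)$. A fuzzy subset of $H$ is a mapping $f:H\to[0,1]$ into the real closed unit interval. For $a\in H$ put $A_a=\{(y,z)\in H\times H\mid a\in y\circ z\}$. For fuzzy subsets $f,g$ of $H$, the fuzzy subset $f\circ g$ of $H$ is defined by $(f\circ g)(a)=\sup_{(y,z)\in A_a}\min\{f(y),g(z)\}$ if $A_a\neq\emptyset$, and $(f\circ g)(a)=0$ if $A_a=\emptyset$. (The same symbol $\circ$ is used for the hyperoperation on $H$ and the product of fuzzy subsets.) When $H$ is a hypersemigroup this product of fuzzy subsets is associative, so iterated products are written without parentheses. The order on fuzzy subsets is $f\preceq g$ if and only if $f(x)\le g(x)$ for every $x\in H$. The symbol $1$ denotes the fuzzy subset of $H$ with $1(x)=1$ for every $x\in H$. *)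

(* Defs.v *)
From mathcomp Require Import all_boot all_order all_algebra.
From mathcomp Require Import boolp classical_sets reals interval_inference.

Set Implicit Arguments.
Unset Strict Implicit.
Unset Printing Implicit Defensive.

Import Order.TTheory GRing.Theory Num.Theory.

Local Open Scope classical_set_scope.
Local Open Scope ring_scope.

Reserved Notation "x ⊙ y" (at level 40, left associativity).
Reserved Notation "A ∗ B" (at level 40, left associativity).
Reserved Notation "f ∘ g" (at level 40, left associativity).
Reserved Notation "f ≼ g" (at level 70, no associativity).

Declare Scope hyper_scope.
Delimit Scope hyper_scope with hyper.
Local Open Scope hyper_scope.

Record hypergroupoid := Hypergroupoid {
  hcarrier :> Type;
  hop : hcarrier -> hcarrier -> set hcarrier;
  hcarrier_neq0 : [set: hcarrier] !=set0;
  hop_neq0 : forall a b, hop a b !=set0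
}.

Notation "x ⊙ y" := (hop x y) : hyper_scope.

Definition hmul (H : hypergroupoid) (A B : set H) : set H :=
  \bigcup_(p in A `*` B) (p.1 ⊙ p.2).

Notation "A ∗ B" := (hmul A B) : hyper_scope.

Record hypersemigroup := Hypersemigroup {
  hgroupoid :> hypergroupoid;
  hopA : forall x y z : hgroupoid, (x ⊙ y) ∗ [set z] = [set x] ∗ (y ⊙ z)
}.

Definition intra_regular (H : hypersemigroup) : Prop :=
  forall a : H, exists x y : H, ((x ⊙ a) ∗ (a ⊙ y)) a.

Section Fuzzy.
Variables (R : realType) (H : hypergroupoid).

Definition fuzzy_subset := H -> {i01 R}.

Definition factors (a : H) : set (H * H) := [set p | (p.1 ⊙ p.2) a].

Definition fprod_val (f g : fuzzy_subset) (a : H) : R :=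
  if `[< factors a !=set0 >] then
    sup [set Num.min (f p.1)%:num (g p.2)%:num | p in factors a]
  else 0.

Lemma fprod_val_ub (f g : fuzzy_subset) (a : H) :
  ubound [set Num.min (f p.1)%:num (g p.2)%:num | p in factors a] (1 : R).
Proof. by move=> _ [p _ <-]; rewrite ge_min; apply/orP; left. Qed.

Lemma fprod_val_ge (f g : fuzzy_subset) (a y z : H) : (y ⊙ z) a ->
  Num.min (f y)%:num (g z)%:num <= fprod_val f g a.
Proof.
move=> ayz; rewrite /fprod_val asboolT; last by exists (y, z).
by apply: ub_le_sup; [exists 1; exact: fprod_val_ub | exists (y, z)].
Qed.

Lemma fprod_val_ge0 (f g : fuzzy_subset) (a : H) : 0 <= fprod_val f g a.
Proof.
have [[[y z] ayz]|E] := pselect (factors a !=set0); last first.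
  by rewrite /fprod_val asboolF.
by apply: le_trans (fprod_val_ge f g ayz); rewrite le_min; apply/andP; split.
Qed.

Lemma fprod_val_le1 (f g : fuzzy_subset) (a : H) : fprod_val f g a <= 1.
Proof.
rewrite /fprod_val; case: asboolP => // -[p ap].
apply: ge_sup; last exact: fprod_val_ub.
by exists (Num.min (f p.1)%:num (g p.2)%:num); exists p.
Qed.

Definition fprod (f g : fuzzy_subset) : fuzzy_subset :=
  fun a => Itv01 (fprod_val_ge0 f g a) (fprod_val_le1 f g a).

Definition fle (f g : fuzzy_subset) : Prop :=
  forall x, (f x)%:num <= (g x)%:num.

Definition fone : fuzzy_subset := fun=> 1%:i01.

Lemma fprod_gtP (f g : fuzzy_subset) (a : H) (t : R) : 0 <= t ->
  t < (fprod f g a)%:num <->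
  exists y z, [/\ (y ⊙ z) a, t < (f y)%:num & t < (g z)%:num].
Proof.
move=> t0; split=> [|[y [z [ayz ty tz]]]]; last first.
  by apply: lt_le_trans (fprod_val_ge f g ayz); rewrite lt_min ty.
rewrite /= /fprod_val; case: asboolP => [[p ap]|_]; last by rewrite ltNge t0.
move=> /sup_gt[|_ [[y z] ayz <-]].
  by exists (Num.min (f p.1)%:num (g p.2)%:num); exists p.
by rewrite lt_min => /andP[ty tz]; exists y, z.
Qed.

End Fuzzy.

Arguments fone {R H}.

Notation "f ∘ g" := (fprod f g) : hyper_scope.
Notation "f ≼ g" := (fle f g) : hyper_scope.

(* Justifies writing iterated products of fuzzy subsets without parentheses. *)
Lemma fprodA (R : realType) (H : hypersemigroup) (f g h : fuzzy_subset R H) :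
  f ∘ (g ∘ h) = f ∘ g ∘ h.
Proof.
have gt_le (u v : fuzzy_subset R H) :
    (forall a t, 0 <= t -> t < (u a)%:num -> t < (v a)%:num) ->
    forall a, (u a)%:num <= (v a)%:num.
  move=> uv a; rewrite leNgt; apply/negP => vu.
  by have := uv a _ [ge0 of (v a)%:num] vu; rewrite ltxx.
apply/funext => a; apply/val_inj/eqP; rewrite eq_le; apply/andP; split;
    apply: gt_le a => a t t0 /(fprod_gtP _ _ _ t0).
- move=> [x [w [axw tx /(fprod_gtP _ _ _ t0) [y [z [wyz ty tz]]]]]].
  have : ([set x] ∗ (y ⊙ z)) a by exists (x, w).
  rewrite -hopA => -[[v z'] [/= vxy ->] avz].
  by apply/(fprod_gtP _ _ _ t0); exists v, z; split=> //;
    apply/(fprod_gtP _ _ _ t0); exists x, y.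
- move=> [v [z [avz /(fprod_gtP _ _ _ t0) [x [y [vxy tx ty]]] tz]]].
  have : ((x ⊙ y) ∗ [set z]) a by exists (v, z).
  rewrite hopA => -[[x' w] [/= -> wyz] axw].
  by apply/(fprod_gtP _ _ _ t0); exists x, w; split=> //;
    apply/(fprod_gtP _ _ _ t0); exists y, z.
Qed.

(* Main.v *)
Require Import Defs.
From mathcomp Require Import all_boot all_order all_algebra.
From mathcomp Require Import boolp classical_sets reals interval_inference.

(** For [0 <= t < 1], the points where a fuzzy product exceeds [t] form the
    hyperproduct of the sets where its factors exceed [t] ([fprod_gtP]), because
    a supremum exceeds [t] exactly when one of its members does. By
    associativity [fone ∘ f ∘ f ∘ fone] is [(fone ∘ f) ∘ (f ∘ fone)], so its
    value at [a] exceeds [t] iff [a] lies in some [(x ⊙ b) ∗ (c ⊙ y)] with [f b]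
    and [f c] above [t] ([fprod_one_sandwich_gtP]).

    If the hypersemigroup is intra-regular, one may always take [b = c = a], so
    the product exceeds every such [t] below [f a]. Conversely, apply the
    inequality to the characteristic function of [{a}]: its product is positive
    at [a], and positivity of the characteristic function forces [b = c = a]. *)

Import Order.TTheory GRing.Theory Num.Theory.

Local Open Scope ring_scope.
Local Open Scope hyper_scope.

(** Grouping the four factors in pairs turns the superlevel set into a
    hyperproduct of the same shape as in the definition of intra-regularity. *)
Lemma fprod_one_sandwich_gtP (R : realType) (H : hypersemigroup)
    (f g : fuzzy_subset R H) (a : H) (t : R) : 0 <= t -> t < 1 ->
  t < ((fone ∘ f ∘ g ∘ fone) a)%:num <->
  exists x b c y,
    [/\ ((x ⊙ b) ∗ (c ⊙ y)) a, t < (f b)%:num & t < (g c)%:num].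
Proof.
move=> t0 t1; rewrite -fprodA fprod_gtP //; split.
- move=> [u [v [auv]]].
  move=> /(fprod_gtP _ _ _ t0) [x [b [uxb _ tb]]].
  move=> /(fprod_gtP _ _ _ t0) [c [y [vcy tc _]]].
  by exists x, b, c, y; split=> //; exists (u, v).
- move=> [x [b [c [y [[[u v] [/= uxb vcy] auv] tb tc]]]]].
  exists u, v; split=> //; apply/(fprod_gtP _ _ _ t0).
  + by exists x, b.
  + by exists c, y.
Qed.

Definition fuzzy_point (R : realType) (H : hypergroupoid) (a : H) :
    fuzzy_subset R H :=
  fun b => if `[< b = a >] then 1%:i01 else 0%:i01.

Lemma fuzzy_point_gt0 (R : realType) (H : hypergroupoid) (a b : H) :
  0 < (fuzzy_point R H a b)%:num <-> b = a.
Proof. by rewrite /fuzzy_point; case: asboolP => ab; rewrite /= ?ltr01 ?ltxx. Qed.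

Theorem theorem7 (R : realType) (H : hypersemigroup) :
  intra_regular H <->
  forall f : fuzzy_subset R H, f ≼ fone ∘ f ∘ f ∘ fone.
Proof.
split=> [regH f a | le_sandwich a].
- have [x [y axy]] := regH a.
  (* If the inequality failed, the product would exceed its own value. *)
  rewrite leNgt; apply/negP; set t := (X in X < _) => tfa.
  have t0 : 0 <= t by exact: fprod_val_ge0.
  have t1 : t < 1 by apply: lt_le_trans tfa _.
  suff : t < t by rewrite ltxx.
  by apply/(fprod_one_sandwich_gtP _ _ _ _ _ _ t0 t1); exists x, a, a, y.
- have : 0 < ((fone ∘ fuzzy_point R H a ∘ fuzzy_point R H a ∘ fone) a)%:num.
    by apply: lt_le_trans (le_sandwich _ a); apply/fuzzy_point_gt0.
  move=> /(fprod_one_sandwich_gtP _ _ _ _ _ _ (lexx 0) ltr01).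
  move=> [x [b [c [y [axy /fuzzy_point_gt0 ba /fuzzy_point_gt0 ca]]]]].
  by exists x, y; move: axy; rewrite ba ca.
Qed.
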